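(* Let $(R,\mathfrak m)$ be a Noetherian local ring and let $N$ be a finitely generated $R$-module. If $x\in\mathfrak mN$, then $$\dim(R/N^*(x))\ge\max_Q\{\dim(R/Q)-rf_Q(N)\},$$ where the maximum is taken over all prime ideals $Q$ of $R$. Thus $$\operatorname{ht}(N^*(x))\le\min_Q\{\dim(R)-\dim(R/Q)+rf_Q(N)\}.$$
   Context: $N^*(x)=\{f(x)\mid f\in\operatorname{Hom}_R(N,R)\}$ is the order ideal of $x$; $rf_Q(N)$ is the maximal rank of a free $R_Q$-module that is a direct summand of $N_Q$. *)

(* Defs.v *)
From HB Require Import structures.
From mathcomp Require Import all_boot all_order all_algebra.
From Stdlib Require Import Classical ClassicalEpsilon.
Set Implicit Arguments. Unset Strict Implicit. Unset Printing Implicit Defensive.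
Import Order.TTheory GRing.Theory Num.Theory.
Local Open Scope ring_scope.

(* sup_nat P = the maximum of P if P has a maximum, 0 otherwise.            *)
Definition sup_nat (P : nat -> Prop) : nat :=
  match excluded_middle_informative
          (exists n, P n /\ forall m, P m -> (m <= n)%N) with
  | left h => proj1_sig (constructive_indefinite_description _ h)
  | right _ => 0%N
  end.

(* inf_nat P = the minimum of P if P is nonempty, 0 otherwise. *)
Definition inf_nat (P : nat -> Prop) : nat :=
  match excluded_middle_informative
          (exists n, P n /\ forall m, P m -> (n <= m)%N) with
  | left h => proj1_sig (constructive_indefinite_description _ h)
  | right _ => 0%N
  end.

Section CommAlg.
Variable R : comNzRingType.

Definition subsetR (I J : R -> Prop) := forall r, I r -> J r.
Definition ssubsetR (I J : R -> Prop) := subsetR I J /\ exists r, J r /\ ~ I r.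

Definition is_ideal (I : R -> Prop) :=
  [/\ I 0, (forall a b, I a -> I b -> I (a + b)) & (forall r a, I a -> I (r * a))].

Definition is_prime (P : R -> Prop) :=
  [/\ is_ideal P, ~ P 1 & (forall a b, P (a * b) -> P a \/ P b)].

Definition noetherian :=
  forall I : nat -> (R -> Prop), (forall n, is_ideal (I n)) ->
    (forall n, subsetR (I n) (I n.+1)) ->
    exists n, forall k, (n <= k)%N -> forall r, I k r <-> I n r.

Definition local_ring (m : R -> Prop) :=
  [/\ is_ideal m, ~ m 1 &
      (forall I, is_ideal I -> ~ I 1 -> subsetR I m)].

Definition prime_chain (P : nat -> (R -> Prop)) (n : nat) :=
  (forall i, (i <= n)%N -> is_prime (P i)) /\
  (forall i, (i < n)%N -> ssubsetR (P i) (P i.+1)).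

Definition dim_quot (I : R -> Prop) : nat :=
  sup_nat (fun n => exists P, prime_chain P n /\ subsetR I (P 0%N)).

Definition krull_dim : nat := dim_quot (fun r => r = 0).

Definition height_prime (P : R -> Prop) : nat :=
  sup_nat (fun n => exists C, prime_chain C n /\ forall r, C n r <-> P r).

Definition height (I : R -> Prop) : nat :=
  inf_nat (fun h => exists P, is_prime P /\ subsetR I P /\ height_prime P = h).

Variable N : lmodType R.

Definition finitely_generated :=
  exists s : seq N, forall v : N, exists c : seq R,
    v = \sum_(i < size s) c`_i *: s`_i.

Definition in_ideal_times_module (m : R -> Prop) (x : N) :=
  exists (a : seq R) (v : seq N), (forall i, (i < size a)%N -> m a`_i) /\
     x = \sum_(i < size a) a`_i *: v`_i.

Definition is_hom (f : N -> R) := forall (a : R) (u v : N), f (a *: u + v) = a * f u + f v.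

Definition order_ideal (x : N) : R -> Prop := fun r => exists f, is_hom f /\ f x = r.

End CommAlg.

Section Localization.
Variables (R : comNzRingType) (Q : R -> Prop).

(* elements of V_Q are represented by pairs (v, s) = v/s with s \notin Q *)
Definition locT (V : lmodType R) := (V * R)%type.
Definition loc_valid (V : lmodType R) (x : locT V) := ~ Q x.2.
Definition loc_eq (V : lmodType R) (x y : locT V) :=
  exists t, ~ Q t /\ t *: (y.2 *: x.1 - x.2 *: y.1) = 0.
Definition loc_add (V : lmodType R) (x y : locT V) : locT V :=
  (y.2 *: x.1 + x.2 *: y.1, x.2 * y.2).
Definition loc_scale (V : lmodType R) (c : locT R^o) (x : locT V) : locT V :=
  (c.1 *: x.1, c.2 * x.2).

Definition loc_linear (V W : lmodType R) (phi : locT V -> locT W) :=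
  [/\ (forall x, loc_valid x -> loc_valid (phi x)),
      (forall x y, loc_valid x -> loc_valid y -> loc_eq x y -> loc_eq (phi x) (phi y)),
      (forall x y, loc_valid x -> loc_valid y ->
          loc_eq (phi (loc_add x y)) (loc_add (phi x) (phi y))) &
      (forall c x, loc_valid c -> loc_valid x ->
          loc_eq (phi (loc_scale c x)) (loc_scale c (phi x)))].

(* R_Q^r is a direct summand of N_Q: there are an R_Q-linear
   iota : R_Q^r -> N_Q (given by the images v_i of the basis vectors) and an
   R_Q-linear pi = (phi_j)_j : N_Q -> R_Q^r with pi \o iota = id. *)
Definition has_free_summand (N : lmodType R) (r : nat) :=
  exists (v : 'I_r -> locT N) (phi : 'I_r -> locT N -> locT R^o),
    (forall i, loc_valid (v i)) /\
    (forall j, loc_linear (phi j)) /\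
    (forall i j, loc_eq (phi j (v i)) ((i == j)%:R, 1)).

Definition rf (N : lmodType R) : nat := sup_nat (has_free_summand N).

End Localization.

(* Main.v *)
(* Let [f 1, ..., f r] be homomorphisms [N -> R] forming a basis of the span of
   [Hom(N, R)] over the residue field of [R_Q]; dualizing them shows [r <= rf_Q(N)].
   Write [x = sum_i a i * e i] with [a i] in [m], and replace the [a i] by variables:
   in [S = R[X 1, ..., X s]], put [F g = sum_i X i * g (e i)].  The primes
   [Q S < (Q, X 1) < ... < (Q, X)] form a chain of length [s]; by Krull's principal
   ideal theorem, cutting it by the [r] linear forms [F (f j)] leaves a chain of
   length at least [s - r] from a prime [P] to [(Q, X)].  Modulo [Q], each [F g] is
   a combination of the [F (f j)] up to a factor outside [Q], so [P] contains all
   the [F g].  Adding the primes [(Q', X)] for [Q <= Q' <= m] and cutting by the [s]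
   elements [X i - a i] gives a chain of length at least [dim R/Q - r] above
   [N^*(x)].  The bound on the height follows from
   [ht I + dim R/I <= dim R]. *)
Require Import Defs.
From mathcomp Require Import all_boot all_order all_algebra.
From mathcomp Require Import ring.
From mathcomp Require Import zify.
From Stdlib Require Import Classical ClassicalEpsilon FunctionalExtensionality PropExtensionality.
Import Order.TTheory GRing.Theory Num.Theory.
Local Open Scope ring_scope.

Set Implicit Arguments. Unset Strict Implicit. Unset Printing Implicit Defensive.

(** * Ideals, saturation at a prime, and Krull's principal ideal theorem *)

Section Ideals.
Variable R : comNzRingType.
Implicit Types I P : R -> Prop.

Lemma pred_ext I J : subsetR I J -> subsetR J I -> I = J.
Proof.
move=> IJ JI; apply: functional_extensionality => r.
by apply: propositional_extensionality; split; [apply: IJ | apply: JI].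
Qed.

Lemma subset_or_ssubset I J : subsetR I J -> I = J \/ ssubsetR I J.
Proof.
move=> IJ; have [JI|nJI] := classic (subsetR J I); first by left; apply: pred_ext.
right; split=> //; apply: NNPP => nex; apply: nJI => r Jr; apply: NNPP => nIr.
by apply: nex; exists r.
Qed.

Lemma ideal0 I : is_ideal I -> I 0. Proof. by case. Qed.

Lemma idealD I a b : is_ideal I -> I a -> I b -> I (a + b).
Proof. by case=> _ D _; apply: D. Qed.

Lemma ideal_mull I a b : is_ideal I -> I b -> I (a * b).
Proof. by case=> _ _; apply. Qed.

Lemma ideal_mulr I a b : is_ideal I -> I a -> I (a * b).
Proof. by move=> iI Ia; rewrite mulrC; apply: ideal_mull. Qed.

Lemma idealN I a : is_ideal I -> I a -> I (- a).
Proof. by move=> iI Ia; rewrite -mulN1r; apply: ideal_mull. Qed.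

Lemma idealB I a b : is_ideal I -> I a -> I b -> I (a - b).
Proof. by move=> iI Ia Ib; apply: idealD => //; apply: idealN. Qed.

Lemma ideal_subl I a b : is_ideal I -> I a -> I (a - b) -> I b.
Proof. by move=> iI Ia Iab; have -> : b = a - (a - b) by [ring]; apply: idealB. Qed.

Lemma ideal_sum I (T : Type) (r : seq T) (p : pred T) (F : T -> R) :
  is_ideal I -> (forall i, p i -> I (F i)) -> I (\sum_(i <- r | p i) F i).
Proof.
move=> iI IF; apply: (big_ind I) => //; first exact: ideal0.
by move=> a b; apply: idealD.
Qed.

Lemma ideal_eq1 I r : is_ideal I -> I 1 -> I r.
Proof. by move=> iI I1; rewrite -[r]mulr1; apply: ideal_mull. Qed.

Lemma prime_ideal P : is_prime P -> is_ideal P. Proof. by case. Qed.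

Lemma primeM P a b : is_prime P -> ~ P a -> ~ P b -> ~ P (a * b).
Proof. by case=> _ _ pM nPa nPb /pM []. Qed.

Lemma primeX P a n : is_prime P -> P (a ^+ n) -> P a.
Proof.
move=> prP; elim: n => [|n IHn]; first by case: prP.
by rewrite exprS; case: (prP) => _ _ pM /pM [].
Qed.

(** Without a maximal member, choice would iterate strict enlargements into an ascending sequence
    that never stabilizes. *)
Lemma noetherian_max (F : (R -> Prop) -> Prop) I0 :
  noetherian R -> (forall I, F I -> is_ideal I) -> F I0 ->
  exists I, F I /\ forall J, F J -> subsetR I J -> subsetR J I.
Proof.
move=> noeR Fid FI0; apply: NNPP => nmax.
have step I : F I -> exists J, F J /\ ssubsetR I J.
  move=> FI; apply: NNPP => nJ; apply: nmax; exists I; split=> // J FJ IJ.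
  have [->|sIJ] := subset_or_ssubset IJ; first by move=> r.
  by case: nJ; exists J.
pose next (u : {I | F I}) : {I | F I} :=
  let: exist J h := constructive_indefinite_description _ (step (proj1_sig u) (proj2_sig u)) in
  exist F J (proj1 h).
have nextP u : ssubsetR (proj1_sig u) (proj1_sig (next u)).
  by rewrite /next; case: constructive_indefinite_description => J [].
pose c n := proj1_sig (iter n next (exist F I0 FI0)).
have [n stab] : exists n, forall k, (n <= k)%N -> forall r, c k r <-> c n r.
  apply: noeR => n; first by apply: Fid; apply: proj2_sig.
  by case: (nextP (iter n next (exist F I0 FI0))).
have [_ [r [cSr ncr]]] := nextP (iter n next (exist F I0 FI0)).
by apply: ncr; apply/(stab n.+1).
Qed.

(** Among the ideals spanned by finitely many elements of [I], a maximal one absorbs every [r] in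
    [I], since [r] could be added to its generators. *)
Lemma noetherian_fg I : noetherian R -> is_ideal I ->
  exists (t : nat) (g : nat -> R), (forall i, (i < t)%N -> I (g i)) /\
    forall J, is_ideal J -> (forall i, (i < t)%N -> J (g i)) -> subsetR I J.
Proof.
move=> noeR iI.
pose span t (g : nat -> R) (r : R) := exists c : nat -> R, r = \sum_(i < t) c i * g i.
have iS t g : is_ideal (span t g).
  split; first by exists (fun=> 0); rewrite big1 // => i _; rewrite mul0r.
    move=> _ _ [c ->] [d ->]; exists (fun i => c i + d i).
    by rewrite -big_split; apply: eq_bigr => i _; rewrite mulrDl.
  move=> r _ [c ->]; exists (fun i => r * c i).
  by rewrite mulr_sumr; apply: eq_bigr => i _; rewrite mulrA.
pose F J := exists t g, (forall i, (i < t)%N -> I (g i)) /\ J = span t g.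
have [||_ [[t [g [Ig ->]]] gmax]] := @noetherian_max F (span 0%N (fun=> 0)) noeR.
- by move=> _ [t [g [_ ->]]].
- by exists 0%N, (fun=> 0).
exists t, g; split=> // J iJ Jg r Ir.
have : span t g r.
  pose g' i := if (i < t)%N then g i else r.
  apply: (gmax (span t.+1 g')).
  - by exists t.+1, g'; split=> // i _; rewrite /g'; case: ifP => // /Ig.
  - move=> _ [c ->]; exists (fun i => if (i < t)%N then c i else 0).
    rewrite big_ord_recr /= ltnn mul0r addr0; apply: eq_bigr => i _.
    by rewrite /g' ltn_ord.
  - exists (fun i => (i == t)%:R); rewrite big_ord_recr /= /g' eqxx ltnn mul1r.
    by rewrite big1 ?add0r // => i _; rewrite (ltn_eqF (ltn_ord i)) mul0r.
by move=> [c ->]; apply: ideal_sum => // i _; apply: ideal_mull => //; apply: Jg.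
Qed.

(** For an ideal [I] and a prime [P]: [I] is contracted from the localization at [P]. Such ideals
    keep local arguments inside [R]. *)
Definition saturated P I := forall t x, ~ P t -> I (t * x) -> I x.

(* The preimage in [R] of the ideal [I + (a)] of the localization at [P]. *)
Definition sat_add P I (a x : R) := exists t r, ~ P t /\ I (t * x - r * a).

Lemma sat_add_ideal P I a : is_prime P -> is_ideal I -> is_ideal (sat_add P I a).
Proof.
move=> prP iI; have nP1 : ~ P 1 by case: prP.
split; first by exists 1, 0; split=> //; rewrite mulr0 mul0r subrr; apply: ideal0.
- move=> x y [t [r [nPt Ix]]] [u [s [nPu Iy]]].
  exists (t * u), (u * r + t * s); split; first exact: primeM.
  have -> : t * u * (x + y) - (u * r + t * s) * a =
    u * (t * x - r * a) + t * (u * y - s * a) by ring.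
  by apply: idealD => //; apply: ideal_mull.
- move=> c x [t [r [nPt Ix]]]; exists t, (c * r); split=> //.
  have -> : t * (c * x) - c * r * a = c * (t * x - r * a) by ring.
  exact: ideal_mull.
Qed.

Lemma sat_add_saturated P I a : is_prime P -> saturated P (sat_add P I a).
Proof.
move=> prP u x nPu [t [r [nPt Ix]]].
by exists (t * u), r; split; [apply: primeM | rewrite -mulrA].
Qed.

Lemma sub_sat_add P I a : is_prime P -> subsetR I (sat_add P I a).
Proof.
by move=> [_ nP1 _] x Ix; exists 1, 0; split=> //; rewrite mul1r mul0r subr0.
Qed.

Lemma mem_sat_add P I a : is_prime P -> is_ideal I -> sat_add P I a a.
Proof.
by move=> [_ nP1 _] iI; exists 1, 1; split=> //; rewrite subrr; apply: ideal0.
Qed.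

Lemma sat_addS P I J a : subsetR I J -> subsetR (sat_add P I a) (sat_add P J a).
Proof. by move=> IJ x [t [r [nPt Ix]]]; exists t, r; split=> //; apply: IJ. Qed.

(* A maximal saturated [I] violating the descending chain condition is prime: if
   [a * b] is in [I], a chain over [I] is controlled by its sum with [(a)] and
   its quotient by [a], which are chains over the larger [I + (a)] and [(I : a)]. *)
Lemma dcc_minimal_prime P I0 (J : nat -> R -> Prop) :
  noetherian R -> is_prime P -> is_ideal I0 -> saturated P I0 ->
  (forall P', is_prime P' -> subsetR I0 P' -> subsetR P' P -> subsetR P P') ->
  (forall n, is_ideal (J n)) -> (forall n, saturated P (J n)) ->
  (forall n, subsetR I0 (J n)) -> (forall n, subsetR (J n.+1) (J n)) ->
  exists n, forall k, (n <= k)%N -> subsetR (J n) (J k).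
Proof.
move=> noeR prP iI0 sI0 minP; have iP := prime_ideal prP.
pose chain I (J : nat -> R -> Prop) := [/\ forall n, is_ideal (J n),
  forall n, saturated P (J n), forall n, subsetR I (J n) &
  forall n, subsetR (J n.+1) (J n)].
pose stable I := forall J, chain I J ->
  exists n, forall k, (n <= k)%N -> subsetR (J n) (J k).
suff st0 : stable I0 by move=> iJ sJ IJ dJ; apply: st0.
apply: NNPP => nst0.
pose F I := [/\ is_ideal I, saturated P I, subsetR I0 I & ~ stable I].
have [||I [[iI sI I0I nst] Imax]] := @noetherian_max F I0 noeR.
- by move=> I [].
- by split=> // r.
have larger I' r : is_ideal I' -> saturated P I' -> subsetR I I' ->
    I' r -> ~ I r -> stable I'.
  move=> iI' sI' II' I'r nIr; apply: NNPP => nst'; apply: nIr.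
  by apply: (Imax I') => //; split=> // x /I0I /II'.
have decr (J' : nat -> R -> Prop) : (forall n, subsetR (J' n.+1) (J' n)) ->
    forall n k, (n <= k)%N -> subsetR (J' k) (J' n).
  move=> dJ' n k; elim: k => [|k IHk]; first by rewrite leqn0 => /eqP ->.
  rewrite leq_eqVlt => /orP [/eqP -> //|nk] x /dJ'; exact: IHk.
have nI1 : ~ I 1.
  move=> I1; apply: nst => J' [iJ' _ IJ' _]; exists 0%N => k _ x _.
  by apply: ideal_eq1 => //; apply: IJ'.
have [prI|nprI] := classic (is_prime I).
  have PI : subsetR P I.
    apply: minP => // x Ix; apply: NNPP => nPx; apply: nI1.
    by apply: (sI x) => //; rewrite mulr1.
  apply: nst => J' [iJ' sJ' IJ' dJ'].
  (* As [P] lies in [I], a member inside [P] lies in all the others; a member not inside [P]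
     contains [1] by saturation. *)
  have [[n J'P]|nJ'P] := classic (exists n, subsetR (J' n) P).
    by exists n => k _ x /J'P /PI /IJ'.
  exists 0%N => k _ x _; apply: ideal_eq1 => //; apply: NNPP => nJ1.
  apply: nJ'P; exists k => z Jz; apply: NNPP => nPz; apply: nJ1.
  by apply: (sJ' k z) => //; rewrite mulr1.
have [a [b [Iab nIa nIb]]] : exists a b, [/\ I (a * b), ~ I a & ~ I b].
  apply: NNPP => nab; apply: nprI; split=> // a b Iab; apply: NNPP => nI.
  by apply: nab; exists a, b; split=> // ?; apply: nI; [left | right].
pose colon (K : R -> Prop) (z : R) := K (z * a).
have colon_ideal K : is_ideal K -> is_ideal (colon K).
  move=> iK; split; rewrite /colon; first by rewrite mul0r; apply: ideal0.
    by move=> u v Ku Kv; rewrite mulrDl; apply: idealD.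
  by move=> u v Kv; rewrite -mulrA; apply: ideal_mull.
have colon_sat K : saturated P K -> saturated P (colon K).
  by move=> sK t z nPt; rewrite /colon -mulrA; apply: sK.
have stA : stable (sat_add P I a).
  apply: (larger _ a) => //; [exact: sat_add_ideal | exact: sat_add_saturated |
    exact: sub_sat_add | exact: mem_sat_add].
have stB : stable (colon I).
  apply: (larger _ b) => //.
  - exact: colon_ideal.
  - exact: colon_sat.
  - by move=> x Ix; apply: ideal_mulr.
  - by rewrite /colon mulrC.
apply: nst => J' [iJ' sJ' IJ' dJ'].
have [|nA stabA] := stA (fun n => sat_add P (J' n) a).
  split=> n; [exact: sat_add_ideal | exact: sat_add_saturated |
    exact: sat_addS | exact: sat_addS].
have [|nB stabB] := stB (fun n => colon (J' n)).
  by split=> n; [exact: colon_ideal | exact: colon_sat |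
    move=> x; exact: (IJ' n (x * a)) | move=> x; exact: (dJ' n (x * a))].
exists (maxn nA nB) => k; rewrite geq_max => /andP [nAk nBk] x Jx.
(* Stability of the sums gives [t * x = r * a] modulo [J' k]; then [r] lies in a colon ideal, and
   stability of the colons moves [r * a] into [J' k]. *)
have [t [r [nPt Jtx]]] : sat_add P (J' k) a x.
  apply: (stabA k nAk); apply: sub_sat_add => //.
  by apply: (decr _ dJ' _ _ (leq_maxl nA nB)).
have Jra : J' k (r * a).
  apply: (stabB k nBk); apply: (decr _ dJ' _ _ (leq_maxr nA nB)).
  apply: (ideal_subl (a := t * x)) => //; first exact: ideal_mull.
  by apply: (decr _ dJ' _ k) => //; rewrite geq_max nAk.
apply: (sJ' k t) => //.
by have -> : t * x = t * x - r * a + r * a by [ring]; apply: idealD.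
Qed.

(** Nakayama's lemma in the localization at [P]. For a maximal saturated [K] over [I] not containing
    [J], adding one [x] of [J] outside [K] captures all of [J]. So locally [x = z * y] and
    [z = c * x] modulo [K], and [1 - c * y] is a unit there. *)
Lemma nakayama_saturated P I J y :
  noetherian R -> is_prime P -> P y -> is_ideal I -> saturated P I ->
  (forall x, J x -> exists t z, [/\ ~ P t, J z & I (t * x - z * y)]) ->
  subsetR J I.
Proof.
move=> noeR prP Py iI sI JI; apply: NNPP => nJI; have iP := prime_ideal prP.
pose F K := [/\ is_ideal K, saturated P K, subsetR I K & ~ subsetR J K].
have [||K [[iK sK IK nJK] Kmax]] := @noetherian_max F I noeR.
- by move=> K [].
- by split=> // r.
have [x [Jx nKx]] : exists x, J x /\ ~ K x.
  apply: NNPP => nex; apply: nJK => x Jx; apply: NNPP => nKx.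
  by apply: nex; exists x.
have JK' : subsetR J (sat_add P K x).
  apply: NNPP => nJK'; apply: nKx; apply: (Kmax (sat_add P K x)).
  - split=> //; [exact: sat_add_ideal | exact: sat_add_saturated |].
    by move=> z /IK; apply: sub_sat_add.
  - exact: sub_sat_add.
  - exact: mem_sat_add.
have [t [z [nPt Jz Ixz]]] := JI x Jx.
have [u [c [nPu Kz]]] := JK' z Jz.
apply: nKx; apply: (sK (u * t - c * y)).
  move=> Ph; apply: (primeM (P := P) (a := u) (b := t)) => //.
  have -> : u * t = u * t - c * y + c * y by ring.
  by apply: idealD => //; apply: ideal_mull.
have -> : (u * t - c * y) * x = u * (t * x - z * y) + y * (u * z - c * x) by ring.
by apply: idealD => //; [apply: ideal_mull => //; apply: IK | apply: ideal_mull].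
Qed.

(* Krull's principal ideal theorem.  If [P2] were minimal over [P0 + (y)], the
   chain [J n + (y)], with [J n] the [P1]-saturation of [P0 + (b ^+ n)], would
   stabilize in the localization at [P2]; by Nakayama so would [J n]. *)
Lemma krull_pit P0 P1 P2 y :
  noetherian R -> is_prime P0 -> is_prime P1 -> is_prime P2 ->
  ssubsetR P0 P1 -> ssubsetR P1 P2 -> P2 y ->
  exists P', [/\ is_prime P', subsetR P0 P', P' y & ssubsetR P' P2].
Proof.
move=> noeR pr0 pr1 pr2 [s01 [b [P1b nP0b]]] s12 P2y; apply: NNPP => nP'.
have [[i0 i1] i2] := (prime_ideal pr0, prime_ideal pr1, prime_ideal pr2).
have nP1y : ~ P1 y by move=> P1y; apply: nP'; exists P1; split.
pose J n := sat_add P1 P0 (b ^+ n).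
have iJ n : is_ideal (J n) by apply: sat_add_ideal.
have sJ n : saturated P1 (J n) by apply: sat_add_saturated.
have dJ n : subsetR (J n.+1) (J n).
  by move=> x [t [c [nPt h]]]; exists t, (c * b); rewrite -mulrA -exprS.
have s02 : subsetR P0 P2 by move=> x /s01; case: s12 => s12 _; apply: s12.
have [|||||||n stab] := @dcc_minimal_prime P2 (sat_add P2 P0 y)
  (fun n => sat_add P2 (J n) y) noeR pr2.
- exact: sat_add_ideal.
- exact: sat_add_saturated.
- move=> P' pr' s0' s'2; have [|->|h] := @subset_or_ssubset P' P2 => //.
  by case: nP'; exists P'; split=> //; [move=> x P0x; apply: s0'; apply: sub_sat_add |
    apply: s0'; apply: mem_sat_add].
- by move=> n; apply: sat_add_ideal.
- by move=> n; apply: sat_add_saturated.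
- by move=> n; apply: sat_addS; apply: sub_sat_add.
- by move=> n; apply: sat_addS.
have JJ : subsetR (J n) (J n.+1).
  apply: (@nakayama_saturated P2 (J n.+1) (J n) y) => //.
    by move=> t x nP2t; apply: sJ => P1t; apply: nP2t; case: s12 => s12 _; apply: s12.
  (* Here [r * y] lies in [J n], which is saturated at [P1], and [y] is outside [P1]; hence [r]
     itself lies in [J n]. *)
  move=> x Jx; have [t [r [nPt h]]] : sat_add P2 (J n.+1) y x.
    by apply: (stab n.+1) => //; apply: sub_sat_add.
  exists t, r; split=> //; apply: (sJ n y) => //; rewrite mulrC.
  by apply: (ideal_subl (a := t * x)) => //; [apply: ideal_mull | apply: dJ].
(* Since [b ^+ n] is outside [P0], the relation forces [t - c * b] into [P0], hence [t] into
   [P1]. *)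
have [t [c [nPt h]]] : J n.+1 (b ^+ n) by apply: JJ; apply: mem_sat_add.
have : P0 (b ^+ n * (t - c * b)).
  by have -> : b ^+ n * (t - c * b) = t * b ^+ n - c * b ^+ n.+1 by rewrite exprS; ring.
case: (pr0) => _ _ pM /pM [/primeX P0b|/s01 P1tb]; first by apply: nP0b; apply: P0b.
by apply: nPt; have -> : t = t - c * b + c * b by [ring]; apply: idealD => //; apply: ideal_mull.
Qed.

End Ideals.

(** * Chains of primes and how they shrink when cut by elements *)

Section Chains.
Variable R : comNzRingType.
Implicit Types P Q M : R -> Prop.

(** Both endpoints are indices, so that chains can be concatenated and their lower ends moved;
    primes are added at the top. *)
Inductive pchain : nat -> (R -> Prop) -> (R -> Prop) -> Prop :=
| pchain0 P : is_prime P -> pchain 0 P P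
| pchainS n P Q M : pchain n P Q -> ssubsetR Q M -> is_prime M -> pchain n.+1 P M.

Lemma pchain_primel n P Q : pchain n P Q -> is_prime P.
Proof. by elim. Qed.

Lemma pchain_primer n P Q : pchain n P Q -> is_prime Q.
Proof. by case. Qed.

Lemma pchain_sub n P Q : pchain n P Q -> subsetR P Q.
Proof. by elim=> [{}P _ r //|{}n {}P {}Q M _ PQ [QM _] _ r /PQ /QM]. Qed.

Lemma pchain_cat n k P Q M : pchain n P Q -> pchain k Q M -> pchain (n + k) P M.
Proof.
move=> PQ QM; elim: QM PQ => [{}Q _|{}k {}Q Q' {}M _ IH Q'M prM] PQ; first by rewrite addn0.
by rewrite addnS; apply: pchainS Q'M prM; apply: IH.
Qed.

Lemma pchain_self n P Q : pchain n P Q -> subsetR Q P -> n = 0%N.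
Proof.
case=> [//|{}n {}P Q' {}Q PQ' [_ [r [Qr nQ'r]]] _ QP].
by case: nQ'r; apply: (pchain_sub PQ'); apply: QP.
Qed.

Lemma pchain_extend n P Q M : pchain n P Q -> subsetR Q M -> is_prime M ->
  exists2 k, (n <= k)%N & pchain k P M.
Proof.
move=> PQ QM prM; have [<-|sQM] := subset_or_ssubset QM; first by exists n.
by exists n.+1 => //; apply: pchainS sQM prM.
Qed.

Lemma pchain_prime_chain n P Q : pchain n P Q ->
  exists C, [/\ prime_chain C n, C 0%N = P & C n = Q].
Proof.
elim=> [{}P prP|{}n {}P {}Q M _ [C [[prC sC] C0 Cn]] QM prM].
  by exists (fun=> P); split=> //; split.
exists (fun i => if (i <= n)%N then C i else M); split; rewrite ?leqnn ?ltnn //.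
split=> i; rewrite leq_eqVlt; first by case: ifP => [/prC //|].
case/orP => [/eqP [->]|lin]; first by rewrite leqnn ltnn Cn.
by rewrite ltnS in lin; rewrite lin (ltnW lin); apply: sC.
Qed.

Lemma prime_chain_pchain n (C : nat -> R -> Prop) : prime_chain C n ->
  pchain n (C 0%N) (C n).
Proof.
elim: n => [|n IHn] [prC sC]; first by apply: pchain0; apply: prC.
apply: pchainS (prC n.+1 _) => //; last by apply: sC.
by apply: IHn; split=> i lin; [apply: prC; apply: ltnW | apply: sC; apply: ltnW].
Qed.

Lemma prime_chain_pchain_from n (C : nat -> R -> Prop) P :
  prime_chain C n -> is_prime P -> subsetR P (C 0%N) -> exists Q, pchain n P Q.
Proof.
case: n => [|n] cC prP PC0; first by exists P; apply: pchain0.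
have [prC sC] := cC.
suff : pchain n.+1 P (C n.+1) by exists (C n.+1).
elim: n cC prC sC => [|n IHn] cC prC sC.
  apply: pchainS (pchain0 prP) _ (prC 1%N _) => //.
  by have [C01 [r [C1r nC0r]]] := sC 0%N isT; split=> [x /PC0|]; [exact: C01 |
    exists r; split=> // Pr; apply: nC0r; apply: PC0].
apply: pchainS (sC n.+1 _) (prC n.+2 _) => //.
have cC' : prime_chain C n.+1.
  by split=> i lin; [apply: prC; apply: ltnW | apply: sC; apply: ltnW].
by apply: IHn => //; case: cC'.
Qed.

(** Krull's theorem is applied from the top downwards: in each triple of consecutive primes the
    middle one is replaced by a prime containing [y]. Only the bottom step is lost. *)
Lemma pchain_cut n P M y : noetherian R -> pchain n P M -> M y ->
  exists P', [/\ pchain n.-1 P' M, subsetR P P' & P' y].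
Proof.
move=> noeR; elim: n M => [|n IHn] M PM My; first by exists P; inversion PM; subst; split.
inversion PM as [|n' P'' Q M' PQ QM prM]; subst; case: n => [|n] in IHn PM PQ *.
  exists M; split=> //; [exact: pchain0 | exact: pchain_sub PM].
inversion PQ as [|n' P'' Q0 M' PQ0 Q0Q prQ]; subst.
have pr0 := pchain_primer PQ0.
have [Q' [prQ' sQ0Q' Q'y Q'M]] : exists Q', [/\ is_prime Q', ssubsetR Q0 Q', Q' y & ssubsetR Q' M].
  have [Q0y|nQ0y] := classic (Q0 y).
    by exists Q; split=> //; case: Q0Q => sQ0Q _; apply: sQ0Q.
  have [Q' [prQ' Q0Q' Q'y Q'M]] := krull_pit noeR pr0 prQ prM Q0Q QM My.
  by exists Q'; split=> //; split=> //; exists y.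
have [P' [P'Q' PP' P'y]] := IHn Q' (pchainS PQ0 sQ0Q' prQ') Q'y.
by exists P'; split=> //; apply: pchainS P'Q' Q'M prM.
Qed.

Lemma pchain_cuts n P M t (y : nat -> R) : noetherian R -> pchain n P M ->
  (forall i, (i < t)%N -> M (y i)) ->
  exists P', [/\ pchain (n - t) P' M, subsetR P P' & forall i, (i < t)%N -> P' (y i)].
Proof.
move=> noeR PM; elim: t => [|t IHt] My; first by exists P; rewrite subn0; split.
have [|P1 [P1M PP1 P1y]] := IHt; first by move=> i /ltnW; apply: My.
have [P' [P'M P1P' P'y]] := pchain_cut noeR P1M (My t (ltnSn t)).
exists P'; rewrite subnS; split=> // [r /PP1 /P1P' //|i].
by rewrite ltnS leq_eqVlt => /orP [/eqP -> //|/P1y /P1P'].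
Qed.

Lemma local_prime M : local_ring M -> is_prime M.
Proof.
case=> iM nM1 Mmax; split=> // a b Mab; apply: NNPP => nM.
have [nMa nMb] : ~ M a /\ ~ M b by split=> ?; apply: nM; [left | right].
(* This is the ideal [M + (a)]; it contains [1], as otherwise it would lie in [M]. *)
pose I x := exists r, M (x - r * a).
have iI : is_ideal I.
  split; first by exists 0; rewrite mul0r subrr; apply: ideal0.
    move=> x y [r Mx] [s My]; exists (r + s).
    have -> : x + y - (r + s) * a = (x - r * a) + (y - s * a) by ring.
    exact: idealD.
  move=> c x [r Mx]; exists (c * r).
  have -> : c * x - c * r * a = c * (x - r * a) by ring.
  exact: ideal_mull.
have [[r Mr]|nI1] := classic (I 1); last first.
  apply: nMa; apply: (Mmax I) => //.
  by exists 1; rewrite mul1r subrr; apply: ideal0.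
apply: nMb; have -> : b = b * (1 - r * a) + r * (a * b) by ring.
by apply: idealD => //; apply: ideal_mull.
Qed.

Lemma local_sub M P : local_ring M -> is_prime P -> subsetR P M.
Proof. by case=> _ _ Mmax [iP nP1 _]; apply: Mmax. Qed.

(** Cutting a chain that ends at [M] by [t] generators of [M] makes it start at [M] too, so its
    remaining length is [0]. *)
Lemma local_chain_bounded M : noetherian R -> local_ring M ->
  exists t, forall n P Q, pchain n P Q -> (n <= t)%N.
Proof.
move=> noeR locM; have prM := local_prime locM.
have [t [g [Mg gM]]] := noetherian_fg noeR (prime_ideal prM).
exists t => n P Q PQ.
have [k nk PM] := pchain_extend PQ (local_sub locM (pchain_primer PQ)) prM.
have [P' [P'M _ P'g]] := pchain_cuts noeR PM Mg.
apply: leq_trans nk _; rewrite -subn_eq0; apply/eqP; apply: (pchain_self P'M).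
by apply: gM => //; apply: prime_ideal; apply: pchain_primel P'M.
Qed.

End Chains.

(** The section [g] makes [h] surjective, so strict inclusions stay strict after pulling back. *)
Lemma pchain_comap (R S : comNzRingType) (h : {rmorphism S -> R}) (g : R -> S) n
    (P Q : R -> Prop) :
  cancel g h -> pchain n P Q -> pchain n (fun x : S => P (h x)) (fun x : S => Q (h x)).
Proof.
move=> gK.
have pr M : is_prime M -> is_prime (fun x : S => M (h x)).
  move=> [iM nM1 pM]; split; rewrite ?rmorph1 //; last by move=> a b; rewrite rmorphM => /pM.
  split=> [|a b Ma Mb|a b Mb]; rewrite ?rmorph0 ?rmorphD ?rmorphM.
  - exact: ideal0.
  - exact: idealD.
  - exact: ideal_mull.
elim=> [{}P /pr|{}n {}P {}Q M _ IH [QM [r [Mr nQr]]] prM]; first exact: pchain0.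
apply: pchainS IH _ (pr _ prM); split=> [x /QM //|].
by exists (g r); rewrite gK.
Qed.

(** * Hilbert's basis theorem and polynomial extensions *)

Section HilbertBasis.
Variable R : comNzRingType.

(** [L k n] is the ideal of degree [k] coefficients of the members of [I n] of degree at most [k].
    It grows in [k] and [n]: the diagonal settles all [k] from [n0] on, and the finitely many
    smaller [k] are settled one by one. Equal ideals [L] then allow leading terms to be removed
    successively. *)
Lemma noetherian_poly : noetherian R -> noetherian {poly R}.
Proof.
move=> noeR I iI sI.
have mI n k : (n <= k)%N -> subsetR (I n) (I k).
  move=> nk; rewrite -(subnKC nk); elim: (k - n)%N => [|j IHj] f; first by rewrite addn0.
  by rewrite addnS => /IHj /sI.
pose L k n (c : R) := exists f, [/\ I n f, (size f <= k.+1)%N & f`_k = c].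
have iL k n : is_ideal (L k n).
  split.
  - by exists 0; rewrite size_poly0 coef0; split=> //; apply: ideal0.
  - move=> _ _ [f [If sf <-]] [g [Ig sg <-]]; exists (f + g); rewrite coefD; split=> //.
      exact: idealD.
    by apply: leq_trans (size_polyD f g) _; rewrite geq_max sf.
  - move=> c _ [f [If sf <-]]; exists (c%:P * f); rewrite coefCM; split=> //.
      exact: ideal_mull.
    by rewrite mul_polyC; apply: leq_trans (size_scale_leq c f) sf.
have LS k k' n n' : (k <= k')%N -> (n <= n')%N -> subsetR (L k n) (L k' n').
  move=> kk' nn' _ [f [If sf <-]]; exists (f * 'X^(k' - k)); split.
  - by rewrite mulrC; apply: ideal_mull => //; apply: mI If.
  - apply: leq_trans (size_polyMleq _ _) _; rewrite size_polyXn addnS /=.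
    by rewrite -(leq_add2r (k' - k)) in sf; move: sf; rewrite addSn subnKC.
  - by rewrite coefMXn ltnNge leq_subr /= subKn.
have [n0 stab0] : exists n, forall k, (n <= k)%N -> forall r, L k k r <-> L n n r.
  by apply: noeR => // n; apply: LS.
have [n1 stab1] : exists n1, forall k, (k < n0)%N -> forall n, (n1 <= n)%N ->
    subsetR (L k n) (L k n1).
  elim: (n0) => [|j [n1 IHj]]; first by exists 0%N.
  have [n2 stab2] := noeR (L j) (iL j) (fun n => LS j j n n.+1 (leqnn j) (leqnSn n)).
  exists (maxn n1 n2) => k; rewrite ltnS leq_eqVlt => /orP [/eqP ->|kj] n.
    rewrite geq_max => /andP [_ n2n] r /(stab2 n n2n).
    by apply: LS => //; apply: leq_maxr.
  rewrite geq_max => /andP [n1n _] r /(IHj k kj n n1n).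
  by apply: LS => //; apply: leq_maxl.
pose n := maxn n0 n1; exists n => k nk f; split; last exact: mI.
have n0n : (n0 <= n)%N := leq_maxl _ _; have n1n : (n1 <= n)%N := leq_maxr _ _.
have LL j : subsetR (L j k) (L j n).
  move=> c; have [n0j|jn0] := leqP n0 j.
    move=> Lc; apply: (LS n0 j n0 n) => //; apply/(stab0 (maxn j k)).
      by rewrite leq_max n0j.
    by apply: (LS j _ k) Lc; [apply: leq_maxl | apply: leq_maxr].
  move=> /(stab1 j jn0 k (leq_trans n1n nk)); exact: LS.
elim: (size f) {-2}f (leqnn (size f)) => [|j IHj] {}f.
  by rewrite size_poly_leq0 => /eqP -> _; apply: ideal0.
move=> sf If; have [g [Ig sg gj]] : L j n f`_j by apply: LL; exists f.
have -> : f = (f - g) + g by rewrite subrK.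
apply: idealD => //; apply: IHj; last by apply: idealB => //; apply: mI Ig.
apply/leq_sizeP => i; rewrite leq_eqVlt coefB => /orP [/eqP <-|ji]; first by rewrite gj subrr.
by rewrite (leq_sizeP _ _ sf) // (leq_sizeP _ _ sg) // subrr.
Qed.

Lemma prime_polyOver (P : R -> Prop) : is_prime P ->
  is_prime (fun f : {poly R} => forall i, P f`_i).
Proof.
move=> prP; have iP := prime_ideal prP; have [_ nP1 pM] := prP; split.
- split=> [i|f g Pf Pg i|f g Pg i].
  + by rewrite coef0; apply: ideal0.
  + by rewrite coefD; apply: idealD.
  + by rewrite coefM; apply: ideal_sum => // j _; apply: ideal_mull.
- by move=> /(_ 0%N); rewrite coef1.
have least (f : {poly R}) : ~ (forall i, P f`_i) ->
    exists i, ~ P f`_i /\ forall j, (j < i)%N -> P f`_j.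
  move=> nPf; apply: NNPP => nex; apply: nPf => i.
  elim/ltn_ind: i => i IHi; apply: NNPP => nPi; by apply: nex; exists i.
move=> f g Pfg; apply: NNPP => nP.
have [|i [nPi Pi]] := least f; first by move=> Pf; apply: nP; left.
have [|j [nPj Pj]] := least g; first by move=> Pg; apply: nP; right.
(* With [i] and [j] the first indices of coefficients outside [P], all other terms of the
   coefficient of degree [i + j] lie in [P]. *)
have := Pfg (i + j)%N; rewrite coefM.
have lij : (i < (i + j).+1)%N by rewrite ltnS leq_addr.
rewrite (bigD1 (Ordinal lij)) //= addKn => Ps.
have /pM [] // : P (f`_i * g`_j).
set s := \sum_(k < _ | _) _ in Ps.
have -> : f`_i * g`_j = f`_i * g`_j + s - s by rewrite addrK.
apply: idealB => //; apply: ideal_sum => // k nk.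
have [ki|ik|ki] := ltngtP k i.
- by apply: ideal_mulr => //; apply: Pi.
- by apply: ideal_mull => //; apply: Pj; have := ltn_ord k; lia.
- by case/eqP: nk; apply: val_inj.
Qed.

End HilbertBasis.

(* [S] is the polynomial ring [R[X 0, ..., X (s - 1)]], with [eps] the evaluation
   at [0]; the last clause is [S = R + (X i - a i)]. *)
Lemma generic_extension (R : comNzRingType) (s : nat) (Q : R -> Prop) :
  noetherian R -> is_prime Q ->
  exists (S : comNzRingType) (iota : {rmorphism R -> S}) (eps : {rmorphism S -> R})
    (X : nat -> S) (C : S -> Prop),
    [/\ noetherian S, cancel iota eps & forall i, (i < s)%N -> eps (X i) = 0] /\
    [/\ pchain s C (fun f : S => Q (eps f)), forall q, Q q -> C (iota q) &
     forall (a : nat -> R) (J : S -> Prop), is_ideal J ->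
       (forall i, (i < s)%N -> J (X i - iota (a i))) ->
       forall f, exists b, J (f - iota b)].
Proof.
move=> noeR prQ.
elim: s => [|s [S [iota [eps [X [C [[noeS epsK epsX] [chC QC mod_a]]]]]]]].
  exists R, idfun, idfun, (fun=> 0), Q; split; split=> //; first exact: pchain0.
  by move=> a J iJ _ f; exists f; rewrite subrr; apply: ideal0.
pose ev0 : {rmorphism {poly S} -> S} := horner_eval 0.
have ev0K : cancel (@polyC S) ev0 by move=> c; rewrite /ev0 /= horner_evalE hornerC.
exists {poly S}, (polyC \o iota : {rmorphism R -> {poly S}}),
  (eps \o ev0 : {rmorphism {poly S} -> R}),
  (fun i => if (i < s)%N then (X i)%:P else 'X), (fun f : {poly S} => forall i, C f`_i).
split; split.
- exact: noetherian_poly.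
- by move=> r; rewrite /= ev0K epsK.
- move=> i _ /=; case: ifP => [lis|_]; first by rewrite ev0K epsX.
  by rewrite /ev0 /= horner_evalE hornerX rmorph0.
(* The new bottom prime is the extension of [C] to [{poly S}]. It lies below the pullback of [C]
   under evaluation at [0], strictly because of ['X]; the old chain is pulled back on top. *)
- have prC := prime_polyOver (pchain_primel chC).
  have ch := pchain_comap ev0K chC.
  rewrite -add1n; apply: (pchain_cat _ ch).
  apply: pchainS (pchain0 prC) _ (pchain_primel ch); split.
    by move=> f Cf; rewrite /ev0 /= horner_evalE horner_coef0.
  exists 'X; split.
    by rewrite /ev0 /= horner_evalE hornerX; apply: ideal0; case: (pchain_primel chC).
  by move/(_ 1%N); rewrite coefX; case: (pchain_primel chC).
- move=> q Qq i /=; rewrite coefC; case: ifP => _; [exact: QC |].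
  by apply: ideal0; case: (pchain_primel chC).
- move=> a J iJ JX f.
  have Js : J ('X - (iota (a s))%:P) by have := JX s (ltnSn s); rewrite ltnn.
  (* Modulo ['X - a s], [f] equals its value at [a s], which lies in [S]; the induction hypothesis
     handles that value. *)
  have /factor_theorem [q fq] : root (f - (f.[iota (a s)])%:P) (iota (a s)).
    by rewrite /root hornerD hornerN hornerC subrr.
  have [|i lis|b Jb] := mod_a a (fun c => J c%:P) _ _ f.[iota (a s)].
  + split=> [|c d Jc Jd|c d Jd]; rewrite ?polyCD ?polyCM ?polyC0.
    * exact: ideal0.
    * exact: idealD.
    * exact: ideal_mull.
  + by have := JX i (ltnW lis); rewrite lis /= polyCB.
  exists b; have -> : f - (polyC \o iota) b =
      (f - (f.[iota (a s)])%:P) + (f.[iota (a s)] - iota b)%:P.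
    by rewrite polyCB addrA subrK.
  rewrite fq.
  by apply: idealD => //; apply: ideal_mull.
Qed.

(** * Maxima and minima of sets of natural numbers *)

Lemma bounded_max (P : nat -> Prop) n t : P n -> (forall k, P k -> (k <= t)%N) ->
  exists k, P k /\ forall l, P l -> (l <= k)%N.
Proof.
move=> Pn; elim: t => [|t IHt] Pt; first by exists n; split=> // l /Pt; rewrite leqn0 => /eqP ->.
have [Pt1|nPt1] := classic (P t.+1); first by exists t.+1.
apply: IHt => k Pk; move: (Pt k Pk); rewrite leq_eqVlt => /orP [/eqP kt|//].
by rewrite kt in Pk.
Qed.

Lemma nonempty_min (P : nat -> Prop) n : P n ->
  exists k, P k /\ forall l, P l -> (k <= l)%N.
Proof.
elim/ltn_ind: n => n IHn Pn.
have [[k [kn Pk]]|nk] := classic (exists k, (k < n)%N /\ P k); first exact: IHn Pk.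
by exists n; split=> // l Pl; rewrite leqNgt; apply/negP => ln; apply: nk; exists l.
Qed.

Lemma sup_natP (P : nat -> Prop) n t : P n -> (forall k, P k -> (k <= t)%N) ->
  P (sup_nat P) /\ forall l, P l -> (l <= sup_nat P)%N.
Proof.
move=> Pn Pt; rewrite /sup_nat; case: excluded_middle_informative => [h|[]].
  by case: constructive_indefinite_description.
exact: bounded_max Pn Pt.
Qed.

Lemma inf_nat_le (P : nat -> Prop) n : P n -> (inf_nat P <= n)%N.
Proof.
move=> Pn; rewrite /inf_nat; case: excluded_middle_informative => [h|[]].
  by case: (constructive_indefinite_description _ h) => k /= [_ le_k]; apply: le_k.
exact: nonempty_min Pn.
Qed.

(** * Dimension and height in a Noetherian local ring *)

Section Dimension.
Variables (R : comNzRingType) (m : R -> Prop).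
Hypotheses (noeR : noetherian R) (locR : local_ring m).
Implicit Types I P Q : R -> Prop.

(** The uniform bound on chain lengths rules out the default value of [sup_nat], so the dimension is
    attained by a chain. *)
Lemma dim_quotP I P n Q : pchain n P Q -> subsetR I P ->
  (n <= dim_quot I)%N /\ exists P' Q', pchain (dim_quot I) P' Q' /\ subsetR I P'.
Proof.
move=> PQ IP; have [t ht] := local_chain_bounded noeR locR.
have [C [cC C0 _]] := pchain_prime_chain PQ.
have [||[C' [cC' IC']] le_dim] := @sup_natP
    (fun n => exists C, prime_chain C n /\ subsetR I (C 0%N)) n t.
- by exists C; rewrite C0.
- by move=> k [C' [/prime_chain_pchain cC' _]]; apply: ht cC'.
split; first by apply: le_dim; exists C; rewrite C0.
by exists (C' 0%N), (C' (dim_quot I)); split=> //; apply: prime_chain_pchain.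
Qed.

Lemma dim_quot_pchain Q : is_prime Q ->
  exists2 d, (dim_quot Q <= d)%N & pchain d Q m.
Proof.
move=> prQ; have [_ [P [P' [PP' QP]]]] := dim_quotP (pchain0 prQ) (fun r Qr => Qr).
have [C [cC C0 _]] := pchain_prime_chain PP'.
have [|Q' QQ'] := prime_chain_pchain_from cC prQ; first by rewrite C0.
by apply: (pchain_extend QQ' _ (local_prime locR)); apply: local_sub (pchain_primer QQ').
Qed.

(** A longest chain above [I] starts at a prime [P] containing [I]; put a longest chain ending at
    [P] below it and use that [height I] is at most the height of [P]. *)
Lemma height_add_dim_quot I : subsetR I m ->
  (height I + dim_quot I <= krull_dim R)%N.
Proof.
move=> Im; have prm := local_prime locR.
have [_ [P [Q [PQ IP]]]] := dim_quotP (pchain0 prm) Im.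
have prP := pchain_primel PQ.
have [t ht] := local_chain_bounded noeR locR.
have [||[C [cC CP]] _] := @sup_natP
    (fun n => exists C, prime_chain C n /\ forall r, C n r <-> P r) 0%N t.
- by exists (fun=> P); split=> //; split.
- by move=> k [C' [/prime_chain_pchain cC' _]]; apply: ht cC'.
have hP : pchain (height_prime P) (C 0%N) P.
  rewrite -[in X in pchain _ _ X](_ : C (height_prime P) = P); first exact: prime_chain_pchain.
  by apply: pred_ext => r /CP.
have [|le_dim _] := @dim_quotP (fun r => r = 0) _ _ _ (pchain_cat hP PQ).
  by move=> r ->; apply: ideal0; apply: prime_ideal; apply: pchain_primel hP.
by apply: leq_trans le_dim; rewrite leq_add2r; apply: inf_nat_le; exists P.
Qed.

End Dimension.

(** * Homomorphisms from [N] to [R] *)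

Section Homomorphisms.
Variables (R : comNzRingType) (N : lmodType R).
Implicit Types f g : N -> R.

Lemma homD f u v : is_hom f -> f (u + v) = f u + f v.
Proof. by move=> hf; rewrite -[u]scale1r hf mul1r scale1r. Qed.

Lemma hom0 f : is_hom f -> f 0 = 0.
Proof. by move=> hf; apply: (addrI (f 0)); rewrite -homD // !addr0. Qed.

Lemma homZ f a u : is_hom f -> f (a *: u) = a * f u.
Proof. by move=> hf; rewrite -[a *: u]addr0 hf hom0 // addr0. Qed.

Lemma homB f u v : is_hom f -> f (u - v) = f u - f v.
Proof. by move=> hf; rewrite -scaleN1r homD // homZ // mulN1r. Qed.

Lemma hom_sum f s (u : nat -> N) : is_hom f ->
  f (\sum_(i < s) u i) = \sum_(i < s) f (u i).
Proof.
move=> hf; elim: s => [|s IHs]; first by rewrite !big_ord0 hom0.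
by rewrite !big_ord_recr /= homD // IHs.
Qed.

Lemma hom_scale c f : is_hom f -> is_hom (fun v => c * f v).
Proof. by move=> hf a u v; rewrite hf; ring. Qed.

Lemma hom_sub f g : is_hom f -> is_hom g -> is_hom (fun v => f v - g v).
Proof. by move=> hf hg a u v; rewrite hf hg; ring. Qed.

Lemma hom_lincomb r (c : nat -> R) (f : nat -> N -> R) :
  (forall j, (j < r)%N -> is_hom (f j)) -> is_hom (fun v => \sum_(j < r) c j * f j v).
Proof.
move=> hf a u v; rewrite mulr_sumr -big_split; apply: eq_bigr => j _ /=.
by rewrite hf //; ring.
Qed.

End Homomorphisms.

(** * Free summands of the localization and dual systems of homomorphisms *)

Section FreeRank.
Variables (R : comNzRingType) (Q : R -> Prop) (N : lmodType R).
Hypothesis prQ : is_prime Q.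

Let iQ : is_ideal Q := prime_ideal prQ.
Let nQ1 : ~ Q 1. Proof. by case: prQ. Qed.

Lemma prime_cancel a b : ~ Q a -> Q (a * b) -> Q b.
Proof. by case: prQ => _ _ pM nQa /pM []. Qed.

(* Equality in the residue field of [R_Q], for fractions. *)
Lemma loc_eq_residue (x y : locT R^o) : loc_eq Q x y -> Q (y.2 * x.1 - x.2 * y.1).
Proof.
case=> t [nQt h]; apply: (prime_cancel nQt).
by move: h; rewrite /GRing.scale /= => ->; apply: ideal0.
Qed.

(** The fractions [w l / u] are the residues of the values of [phi] at the [e l], brought to a
    common denominator. *)
Lemma loc_linear_lincomb (phi : locT N -> locT R^o) (e : nat -> N) s :
  loc_linear Q phi -> exists u (w : nat -> R), ~ Q u /\ forall c : nat -> R,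
    let y := phi (\sum_(l < s) c l *: e l, 1) in
    Q (u * y.1 - y.2 * \sum_(l < s) c l * w l).
Proof.
case=> val _ add scal; have val1 v : ~ Q (phi (v, 1)).2 by apply: val.
elim: s => [|s [u [w [nQu IHs]]]].
  exists 1, (fun=> 0); split=> // c /=; rewrite !big_ord0 mulr0 subr0 mul1r.
  have /loc_eq_residue := scal (0, 1) (0, 1) nQ1 nQ1.
  rewrite /loc_scale /= scale0r mulr1 /GRing.scale /= mul0r mulr0 subr0 mul1r.
  exact: prime_cancel (val1 0).
set p := phi (e s, 1).
exists (u * p.2), (fun l => if (l < s)%N then w l * p.2 else u * p.1).
split=> [|c /=]; first by apply: (primeM prQ nQu); apply: val1.
rewrite !big_ord_recr /= ltnn.
rewrite (eq_bigr (fun l : 'I_s => c l * w l * p.2)) => [|l _]; last by rewrite ltn_ord mulrA.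
rewrite -mulr_suml.
set v := \sum_(l < s) _ *: _; set sigma := \sum_(l < s) _.
set z := phi (v, 1); set q := phi (c s *: e s, 1); set y := phi _.
have hA : Q (p.2 * q.1 - q.2 * (c s * p.1)).
  have /loc_eq_residue := scal (c s, 1) (e s, 1) nQ1 nQ1.
  by rewrite /loc_scale /= mulr1 mul1r.
have hB : Q (z.2 * q.2 * y.1 - y.2 * (q.2 * z.1 + z.2 * q.1)).
  have /loc_eq_residue := add (v, 1) (c s *: e s, 1) nQ1 nQ1.
  by rewrite /loc_add /= !scale1r mulr1.
have hD : Q (u * z.1 - z.2 * sigma) by apply: IHs.
apply: (@prime_cancel (z.2 * q.2)); first by apply: primeM => //; apply: val1.
have -> : z.2 * q.2 * (u * p.2 * y.1 - y.2 * (sigma * p.2 + c s * (u * p.1))) =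
  u * p.2 * (z.2 * q.2 * y.1 - y.2 * (q.2 * z.1 + z.2 * q.1)) +
  (y.2 * q.2 * p.2 * (u * z.1 - z.2 * sigma) +
   y.2 * z.2 * u * (p.2 * q.1 - q.2 * (c s * p.1))) by ring.
by apply: idealD => //; [|apply: idealD => //]; apply: ideal_mull.
Qed.

Lemma det_congr r (A B : 'M[R]_r) :
  (forall i j, Q (A i j - B i j)) -> Q (\det A - \det B).
Proof.
move=> AB; pose K x y := Q (x - y).
have KD a a' b b' : K a a' -> K b b' -> K (a + b) (a' + b').
  move=> Ka Kb; rewrite /K.
  have -> : a + b - (a' + b') = (a - a') + (b - b') by ring.
  exact: idealD.
have KM a a' b b' : K a a' -> K b b' -> K (a * b) (a' * b').
  move=> Ka Kb; rewrite /K.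
  have -> : a * b - a' * b' = b * (a - a') + a' * (b - b') by ring.
  by apply: idealD => //; apply: ideal_mull.
have K0 x : K x x by rewrite /K subrr; apply: ideal0.
apply: (big_ind2 K (K0 0) KD) => s _; apply: (KM) => //.
by apply: (big_ind2 K (K0 1) KM) => i _; apply: AB.
Qed.

(** The matrix factors through [R^s]; padding the factors to square matrices gives the first one a
    zero column. *)
Lemma det_mul_thin (r s : nat) (c w : 'I_r -> nat -> R) : (s < r)%N ->
  \det (\matrix_(i < r, j < r) \sum_(l < s) c i l * w j l) = 0.
Proof.
move=> sr; pose A := \matrix_(i < r, k < r) (if (k < s)%N then c i k else 0).
pose B := \matrix_(k < r, j < r) (w j k).
have -> : \matrix_(i < r, j < r) (\sum_(l < s) c i l * w j l) = A *m B.
  apply/matrixP => i j; rewrite !mxE (big_ord_widen r (fun l => c i l * w j l) (ltnW sr)).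
  rewrite big_mkcond; apply: eq_bigr => k _; rewrite !mxE.
  by case: ifP => // _; rewrite mul0r.
rewrite det_mulmx (expand_det_col A (Ordinal sr)) big1 ?mul0r // => i _.
by rewrite mxE ltnn mul0r.
Qed.

(** With more basis vectors than generators, the matrix of the [phi j (v i)], cleared of
    denominators, would have determinant [0], yet be congruent modulo [Q] to a diagonal matrix with
    diagonal entries outside [Q]. The bound makes [rf] a genuine maximum. *)
Lemma free_summand_bound : finitely_generated N ->
  exists t, forall r, has_free_summand Q N r -> (r <= t)%N.
Proof.
move=> [e gen]; exists (size e) => r [v [phi [val_v [lin_phi dual]]]].
rewrite leqNgt; apply/negP => sr.
have /fin_all_exists [c vc] : forall i : 'I_r, exists c : nat -> R,
    (v i).1 = \sum_(l < size e) c l *: e`_l.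
  by move=> i; have [c ->] := gen (v i).1; exists (nth 0 c).
have [u [w [nQu uw]]] : exists (u : 'I_r -> R) (w : 'I_r -> nat -> R),
    (forall j, ~ Q (u j)) /\ forall j (c : nat -> R),
    let y := phi j (\sum_(l < size e) c l *: e`_l, 1) in
    Q (u j * y.1 - y.2 * \sum_(l < size e) c l * w j l).
  have /fin_all_exists [u] := fun j => loc_linear_lincomb (nth 0 e) (size e) (lin_phi j).
  move=> /fin_all_exists [w uw]; exists u, w.
  by split=> j; [case: (uw j) | case: (uw j)].
(* Modulo [Q], [A i j] is [u j] times the value of [phi j] at the numerator of [v i], and that value
   is [(v i).2] times the one at [v i]. *)
pose A := \matrix_(i < r, j < r) \sum_(l < size e) c i l * w j l.
pose D := diag_mx (\row_(i < r) (u i * (v i).2)).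
have AD : Q (\det A - \det D).
  apply: det_congr => i j; rewrite !mxE.
  set sigma := \sum_(l < _) _; have := uw j (c i); rewrite -vc -/sigma /=.
  set z := phi j _ => hz.
  case: (lin_phi j) => val eqv _ scal.
  have nQz : ~ Q z.2 by apply: val.
  have nQy : ~ Q (phi j (v i)).2 by apply: val.
  have nQt : ~ Q (v i).2 := val_v i.
  have /loc_eq_residue := dual i j; have /loc_eq_residue := scal ((v i).2, 1) (v i) nQ1 nQt.
  have : loc_eq Q (phi j ((v i).1, 1)) (phi j (loc_scale ((v i).2, 1) (v i))).
    apply: eqv => //; rewrite /loc_valid /= ?mul1r //.
    by exists 1; split=> //=; rewrite scale1r mul1r scale1r subrr.
  move=> /loc_eq_residue; rewrite -/z /=.
  set x := phi j (loc_scale _ _); set y := phi j (v i); set t := (v i).2.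
  have nQx : ~ Q x.2 by apply: val; rewrite /loc_valid /= mul1r.
  rewrite /GRing.scale /= !mul1r => hzx hxy hy.
  apply: (@prime_cancel (z.2 * x.2 * y.2)); first by do 2?apply: primeM.
  set dl : R := (i == j)%:R in hy *.
  have -> : u i * t *+ (i == j) = u j * t * dl.
    by rewrite /dl; case: eqVneq => [->|_]; rewrite ?mulr1 ?mulr0.
  have -> : z.2 * x.2 * y.2 * (sigma - u j * t * dl) =
    u j * y.2 * (x.2 * z.1 - z.2 * x.1) + u j * z.2 * (y.2 * x.1 - x.2 * (t * y.1))
    + u j * z.2 * x.2 * t * (y.1 - y.2 * dl) - x.2 * y.2 * (u j * z.1 - z.2 * sigma) by ring.
  by apply: idealB => //; [apply: idealD => //; [apply: idealD => //|]|]; apply: ideal_mull.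
have QD : Q (\det D).
  by move: AD; rewrite /A (det_mul_thin _ w sr) sub0r => /(idealN iQ); rewrite opprK.
move: QD; rewrite det_diag.
apply: (big_ind (fun z => ~ Q z)) => // [a b|i _]; first exact: primeM.
by rewrite mxE; apply: primeM => //; apply: val_v.
Qed.

(** The fractions [n i / d] and the localized [f j] are dual to each other. *)
Lemma free_summand_of_homs r (f : nat -> N -> R) (n : nat -> N) d :
  ~ Q d -> (forall j, (j < r)%N -> is_hom (f j)) ->
  (forall i j, (i < r)%N -> (j < r)%N -> f j (n i) = d *+ (i == j)) ->
  has_free_summand Q N r.
Proof.
move=> nQd hf fn.
exists (fun i => (n i, d)), (fun j v => (f j v.1, v.2)); split=> //; split.
  move=> j; have hfj := hf j (ltn_ord j); split=> //= [x y _ _ [t [nQt h]]|x y _ _|c x _ _].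
  - exists t; split=> //=.
    by have := congr1 (f j) h; rewrite (hom0 hfj) (homZ _ _ hfj) (homB _ _ hfj) !(homZ _ _ hfj).
  - by exists 1; split=> //=; rewrite (homD _ _ hfj) !(homZ _ _ hfj) subrr scaler0.
  - by exists 1; split=> //=; rewrite (homZ _ _ hfj) subrr scaler0.
move=> i j; exists 1; split=> //=; rewrite fn // /GRing.scale /= !mul1r.
by rewrite mulr_natr subrr.
Qed.

(* A maximal system of homomorphisms [f j], dual up to the factor [d] to a family
   in [N], spans [Hom(N, R)] over the residue field of [R_Q]. *)
Lemma maximal_dual_system : finitely_generated N ->
  exists (r : nat) (f : nat -> N -> R) (d : R),
    [/\ (r <= rf Q N)%N, ~ Q d, forall j, (j < r)%N -> is_hom (f j) &
     forall g, is_hom g -> exists c : nat -> R, forall v,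
       Q (d * g v - \sum_(j < r) c j * f j v)].
Proof.
move=> fgN; have [t ht] := free_summand_bound fgN.
pose Sys r := exists (f : nat -> N -> R) (n : nat -> N) d,
  [/\ ~ Q d, forall j, (j < r)%N -> is_hom (f j) &
   forall i j, (i < r)%N -> (j < r)%N -> f j (n i) = d *+ (i == j)].
have SysF r : Sys r -> has_free_summand Q N r.
  by move=> [f [n [d [nQd hf fn]]]]; apply: free_summand_of_homs fn.
have Sys0 : Sys 0%N by exists (fun _ _ => 0), (fun=> 0), 1.
have [r [[f [n [d [nQd hf fn]]]] rmax]] := bounded_max Sys0 (fun k Sk => ht k (SysF k Sk)).
have Sr : Sys r by exists f, n, d.
exists r, f, d; split=> //.
  by have [_ le_rf] := sup_natP (SysF r Sr) ht; apply: (le_rf r (SysF r Sr)).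
move=> g hg; exists (fun j => g (n j)) => v.
(* Gram-Schmidt without division: [g'] vanishes at every [n i], and [v'] below is killed by every
   [f j]. *)
pose g' v := d * g v - \sum_(j < r) g (n j) * f j v.
have hg' : is_hom g' := hom_sub (hom_scale d hg) (hom_lincomb (fun j => g (n j)) hf).
have g'n i : (i < r)%N -> g' (n i) = 0.
  move=> ir; rewrite /g' (bigD1 (Ordinal ir)) //= fn // eqxx big1 ?addr0.
    by rewrite mulrC subrr.
  move=> j; rewrite -val_eqE /= eq_sym => /negbTE ji.
  by rewrite fn // ji mulr0.
pose v' := d *: v - \sum_(i < r) f i v *: n i.
have fv' j : (j < r)%N -> f j v' = 0.
  move=> jr; have hfj := hf j jr; rewrite /v' (homB _ _ hfj) (homZ _ _ hfj).
  rewrite (hom_sum _ (fun i => f i v *: n i) hfj) (bigD1 (Ordinal jr)) //=.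
  rewrite (homZ _ _ hfj) fn // eqxx.
  rewrite big1 ?addr0; first by rewrite mulrC subrr.
  move=> i; rewrite -val_eqE /= => /negbTE ij.
  by rewrite (homZ _ _ hfj) fn // ij mulr0.
have g'v' : g' v' = d * g' v.
  rewrite /v' homB // homZ // (hom_sum _ (fun i => f i v *: n i)) // big1 ?subr0 // => i _.
  by rewrite homZ // g'n // mulr0.
apply: NNPP => nQg; suff : Sys r.+1 by move/rmax; rewrite ltnn.
(* If [g' v] were outside [Q], then [g'] and [v'] would enlarge the system; the scalings make every
   diagonal value [d * (d * g' v)]. *)
exists (fun j => if (j < r)%N then f j else g').
exists (fun i => if (i < r)%N then (d * g' v) *: n i else d *: v'), (d * (d * g' v)).
split=> [|j _|i j].
- by do 2?apply: primeM.
- by case: ifP => // /hf.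
rewrite !ltnS (leq_eqVlt i) (leq_eqVlt j) => /orP [/eqP ->|ir] /orP [/eqP ->|jr].
- by rewrite ltnn homZ // g'v' eqxx.
- by rewrite ltnn jr homZ ?fv' ?mulr0 ?(gtn_eqF jr) //; apply: hf.
- by rewrite ltnn ir homZ // g'n // mulr0 (ltn_eqF ir).
- rewrite ir jr homZ ?fn //; last exact: hf.
  by case: eqVneq => _; rewrite ?mulr0 // mulrC.
Qed.

End FreeRank.

(** * Specialization of the coefficients and the two inequalities *)

(** As [R] maps onto [S] modulo [P], primes above [P] are determined by their preimages in [R], so
    inclusions stay strict. *)
Lemma pchain_retract (R S : comNzRingType) (iota : {rmorphism R -> S}) n (P M : S -> Prop) :
  (forall f, exists b, P (f - iota b)) -> pchain n P M ->
  pchain n (fun b => P (iota b)) (fun b => M (iota b)).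
Proof.
move=> mod_P PM.
have pr (P' : S -> Prop) : is_prime P' -> is_prime (fun b => P' (iota b)).
  move=> [iP' nP'1 pM]; split; rewrite ?rmorph1 //; last by move=> a b; rewrite rmorphM => /pM.
  split=> [|a b Pa Pb|a b Pb]; rewrite ?rmorph0 ?rmorphD ?rmorphM.
  - exact: ideal0.
  - exact: idealD.
  - exact: ideal_mull.
elim: PM mod_P => [{}P /pr prP _|{}n {}P Q {}M PQ IH [QM [f [Mf nQf]]] prM mod_P].
  exact: pchain0.
apply: pchainS (IH mod_P) _ (pr _ prM); split=> [b /QM //|].
have [b Pfb] := mod_P f; have Qfb := pchain_sub PQ Pfb; exists b; split.
  by apply: (ideal_subl (a := f)) => //; [apply: prime_ideal | apply: QM].
move=> Qb; apply: nQf; rewrite -[f](subrK (iota b)).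
by apply: idealD => //; apply: prime_ideal; apply: pchain_primer PQ.
Qed.

(* Generic coefficients [X i] in place of [a i] leave room to cut the chain of
   length [s] inside [(Q, X)], where [delta] is still invertible, by the [r] linear
   forms coming from the [f j]; only then [X i] is specialized to [a i]. *)
Lemma order_ideal_chain (R : comNzRingType) (m Q : R -> Prop) (N : lmodType R)
    (s r d : nat) (a : nat -> R) (e : nat -> N) (f : nat -> N -> R) (delta : R) :
  noetherian R -> pchain d Q m ->
  (forall i, (i < s)%N -> m (a i)) -> ~ Q delta ->
  (forall g, is_hom g -> exists c : nat -> R, forall v,
       Q (delta * g v - \sum_(j < r) c j * f j v)) ->
  exists n P, [/\ (d - r <= n)%N, pchain n P m &
    subsetR (order_ideal (\sum_(i < s) a i *: e i)) P].
Proof.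
move=> noeR Qm ma nQd spanf.
have prQ := pchain_primel Qm; have im := prime_ideal (pchain_primer Qm).
have [S [iota [eps [X [C [[noeS epsK epsX] [chC QC mod_a]]]]]]] :=
  generic_extension s noeR prQ.
pose F (g : N -> R) := \sum_(i < s) X i * iota (g (e i)).
have epsF g : eps (F g) = 0.
  by rewrite rmorph_sum big1 // => i _; rewrite rmorphM epsX // mul0r.
have [|P1 [P1Q CP1 P1f]] := pchain_cuts (t := r) (y := fun j => F (f j)) noeS chC.
  by move=> j _; rewrite epsF; apply: ideal0; apply: prime_ideal.
have pr1 := pchain_primel P1Q; have i1 := prime_ideal pr1.
have P1F g : is_hom g -> P1 (F g).
  move=> hg; have [c gc] := spanf g hg.
  have nP1d : ~ P1 (iota delta) by move/(pchain_sub P1Q); rewrite epsK.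
  apply: (prime_cancel pr1 nP1d).
  (* The coefficients in the first sum lie in [Q], whose image lies in [C] and so in [P1]; the
     second sum combines forms already cut. *)
  have -> : iota delta * F g =
      \sum_(i < s) X i * iota (delta * g (e i) - \sum_(j < r) c j * f j (e i)) +
      \sum_(j < r) iota (c j) * F (f j).
    have -> : \sum_(j < r) iota (c j) * F (f j) =
        \sum_(i < s) X i * iota (\sum_(j < r) c j * f j (e i)).
      under eq_bigr do rewrite mulr_sumr.
      rewrite exchange_big; apply: eq_bigr => i _; rewrite rmorph_sum mulr_sumr.
      by apply: eq_bigr => j _; rewrite rmorphM mulrCA.
    rewrite -big_split mulr_sumr; apply: eq_bigr => i _ /=.
    by rewrite rmorphB rmorphM -mulrDr subrK mulrCA.
  apply: idealD => //; apply: ideal_sum => // i _; apply: ideal_mull => //.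
    by apply: CP1; apply: QC.
  exact: P1f.
(* The chain from [P1] to [(Q, X)] is continued up to [(m, X)], which contains every [X i - a i]. *)
have ch := pchain_cat P1Q (pchain_comap epsK Qm).
have [|P2 [P2m P12 P2X]] := pchain_cuts (t := s) (y := fun i => X i - iota (a i)) noeS ch.
  by move=> i lis; rewrite rmorphB epsX // epsK sub0r; apply: idealN; last exact: ma.
have i2 := prime_ideal (pchain_primel P2m).
have := pchain_retract (mod_a a P2 i2 P2X) P2m.
have -> : (fun b => m (eps (iota b))) = m by apply: pred_ext => b; rewrite epsK.
(* With truncated subtraction this length is [d - r] if [r <= s], and [d - s] otherwise. *)
move=> P2m'; exists (s - r + d - s)%N, (fun b => P2 (iota b)); split=> //; first by lia.
move=> b [g [hg <-]]; rewrite (hom_sum _ (fun i => a i *: e i)) //.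
(* Modulo [P2], each [X i] becomes [a i], so [F g] becomes the value of [g] at the given sum. *)
apply: (ideal_subl (a := F g)) => //; first by apply: P12; apply: P1F.
rewrite rmorph_sum /F -sumrB; apply: ideal_sum => // i _.
by rewrite homZ // rmorphM -mulrBl; apply: ideal_mulr => //; apply: P2X.
Qed.

Theorem theorem3p5 (R : comNzRingType) (m : R -> Prop) (N : lmodType R) (x : N) :
  noetherian R -> local_ring m -> finitely_generated N ->
  in_ideal_times_module m x ->
  (forall Q : R -> Prop, is_prime Q ->
     (dim_quot Q)%:Z - (rf Q N)%:Z <= (dim_quot (order_ideal x))%:Z) /\
  (forall Q : R -> Prop, is_prime Q ->
     (height (order_ideal x))%:Z
       <= (krull_dim R)%:Z - (dim_quot Q)%:Z + (rf Q N)%:Z).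
Proof.
move=> noeR locR fgN [a [v [ma xE]]].
have dim_le Q : is_prime Q -> (dim_quot Q <= dim_quot (order_ideal x) + rf Q N)%N.
  move=> prQ; have [d dimQ Qm] := dim_quot_pchain noeR locR prQ.
  have [r [f [delta [r_rf nQd hf spanf]]]] := maximal_dual_system prQ fgN.
  have [n [P [dn Pm]]] := order_ideal_chain (nth 0 v) noeR Qm ma nQd spanf.
  rewrite -xE => IP; have [n_dim _] := dim_quotP noeR locR Pm IP; lia.
(* Since [x] lies in [m N], every homomorphism sends it into [m]; so the bound on height plus
   dimension applies. *)
have Im : subsetR (order_ideal x) m.
  have im := prime_ideal (local_prime locR).
  move=> _ [f [hf <-]]; rewrite xE (hom_sum _ (fun i => a`_i *: v`_i)) //.
  by apply: ideal_sum => // i _; rewrite homZ //; apply: ideal_mulr => //; apply: ma.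
have ht_le := height_add_dim_quot noeR locR Im.
by split=> Q /dim_le; lia.
Qed.
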